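(* Let $\mathbb{K}$ be $\mathbb{R}$ or $\mathbb{C}$, let $n\geq 1$, and let $A\subset\mathbb{K}^n$ be a non-flat compact set with convex hull $\widehat{A}$. Let $\mathfrak{E}_1$ and $\mathfrak{E}_2$ be two maximal inscribed ellipsoids (MaIE) of $A$, i.e. ellipsoids in $\mathbb{K}^n$ contained in $\widehat{A}$ and having maximal volume among all ellipsoids in $\mathbb{K}^n$ contained in $\widehat{A}$. Then there is a vector $\mathbf{c}\in\mathbb{K}^n$ such that $\mathfrak{E}_2=\mathfrak{E}_1+\mathbf{c}$. Moreover, if $\mathbb{K}=\mathbb{R}$, then $\mathfrak{E}_1=\mathfrak{E}_2$.
   Context: An ellipsoid in $\mathbb{K}^n$ is any translate (by a vector of $\mathbb{K}^n$) of a set $\{\mathbf{x}\in\mathbb{K}^n : \mathbf{x}^{T}M\overline{\mathbf{x}}\leq 1\}$, where $M$ is an $n\times n$ positive definite Hermitian matrix over $\mathbb{K}$ (symmetric if $\mathbb{K}=\mathbb{R}$); equivalently, it is the image of the closed unit ball of $\mathbb{K}^n$ under an invertible $\mathbb{K}$-affine map. For $\mathbb{K}=\mathbb{C}$ these are called complex ellipsoids. Convexity in $\mathbb{C}^n$ is real convexity, inherited from the identification $\mathbb{C}^n=\mathbb{R}^{2n}$, and $\widehat{A}$ denotes the (real) convex hull of $A$. Volume is Lebesgue measure on $\mathbb{R}^n$, respectively on $\mathbb{C}^n=\mathbb{R}^{2n}$. A compact set is non-flat if it is not contained in a real affine hyperplane (of $\mathbb{R}^n$, respectively of $\mathbb{R}^{2n}=\mathbb{C}^n$),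 i.e. if its convex hull has nonempty interior. *)

(* Defs.v *)
From HB Require Import structures.
From mathcomp Require Import all_boot all_order all_algebra.
From mathcomp Require Import sesquilinear complex.
From mathcomp Require Import all_classical all_reals all_analysis.
Set Implicit Arguments.
Unset Strict Implicit.
Unset Printing Implicit Defensive.
Import Order.TTheory GRing.Theory Num.Theory.
Import numFieldNormedType.Exports.
Local Open Scope classical_set_scope.
Local Open Scope ring_scope.

Inductive scalars := RealScalars | ComplexScalars.

Definition scalar_field (R : realType) (K : scalars) : numFieldType :=
  match K with
  | RealScalars => R : numFieldType
  | ComplexScalars => R[i] : numFieldType
  end.

Definition scalar_conj (R : realType) (K : scalars) :
    {rmorphism scalar_field R K -> scalar_field R K} :=
  match K with
  | RealScalars => idfun
  | ComplexScalars => @conjc R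
  end.

Definition real_dim (K : scalars) (n : nat) : nat :=
  match K with
  | RealScalars => n
  | ComplexScalars => n + n
  end.

(* The identification of C^n with R^(2n) lists the n real parts first, then
   the n imaginary parts. *)
Definition real_coords (R : realType) (K : scalars) (n : nat) :
    'cV[scalar_field R K]_n -> (real_dim K n).-tuple (measurableTypeR R) :=
  match K return
    'cV[scalar_field R K]_n -> (real_dim K n).-tuple (measurableTypeR R) with
  | RealScalars => fun x => [tuple x i 0 | i < n]
  | ComplexScalars => fun x =>
      [tuple of [tuple complex.Re (x i 0) | i < n] ++
                [tuple complex.Im (x i 0) | i < n]]
  end.

(* m-dimensional Lebesgue measure, as the iterated product of the Lebesgue
   measure of R, transported along (x, v) |-> x :: v. *)
Fixpoint lebesgue_tuple (R : realType) (m : nat) :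
    set (m.-tuple (measurableTypeR R)) -> \bar R :=
  match m return set (m.-tuple (measurableTypeR R)) -> \bar R with
  | 0%N => \d_[tuple]
  | m'.+1 => pushforward
      (@lebesgue_measure R \x @lebesgue_tuple R m')%E
      (fun p => [tuple of p.1 :: p.2])
  end.

Definition volume (R : realType) (K : scalars) (n : nat)
    (A : set 'cV[scalar_field R K]_n) : \bar R :=
  lebesgue_tuple (@real_coords R K n @` A).

(* For K = C this is still convexity over R: in the partial order of R[i],
   the weights t with 0 <= t <= 1 are exactly the real ones. *)
Definition convex_hull (R : realType) (K : scalars) (n : nat)
    (A : set 'cV[scalar_field R K]_n) : set 'cV[scalar_field R K]_n :=
  smallest (@convex_set (scalar_field R K) 'cV[scalar_field R K]_n) A.

Definition real_hyperplane (R : realType) (K : scalars) (n : nat)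
    (a : (real_dim K n).-tuple R) (b : R) : set 'cV[scalar_field R K]_n :=
  [set x | \sum_(i < real_dim K n) tnth a i * tnth (real_coords x) i = b].

Definition non_flat (R : realType) (K : scalars) (n : nat)
    (A : set 'cV[scalar_field R K]_n) : Prop :=
  ~ exists (a : (real_dim K n).-tuple R) (b : R),
      (exists i, tnth a i != 0) /\ A `<=` real_hyperplane a b.

Definition herm_form (R : realType) (K : scalars) (n : nat)
    (M : 'M[scalar_field R K]_n) (x : 'cV[scalar_field R K]_n) : scalar_field R K :=
  (x^T *m M *m map_mx (@scalar_conj R K) x) 0 0.

(* For K = C, [0 < z] in the partial order of R[i] says that z is real and
   positive. *)
Definition posdef_hermitian (R : realType) (K : scalars) (n : nat)
    (M : 'M[scalar_field R K]_n) : Prop :=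
  M \is (false, @scalar_conj R K).-sesqui /\
  forall x : 'cV[scalar_field R K]_n, x != 0 -> 0 < herm_form M x.

Definition is_ellipsoid (R : realType) (K : scalars) (n : nat)
    (E : set 'cV[scalar_field R K]_n) : Prop :=
  exists (M : 'M[scalar_field R K]_n) (c : 'cV[scalar_field R K]_n),
    posdef_hermitian M /\ E = [set x + c | x in [set x | herm_form M x <= 1]].

Definition is_MaIE (R : realType) (K : scalars) (n : nat)
    (A E : set 'cV[scalar_field R K]_n) : Prop :=
  [/\ is_ellipsoid E,
      E `<=` convex_hull A
    & forall E' : set 'cV[scalar_field R K]_n,
        is_ellipsoid E' -> E' `<=` convex_hull A ->
        (volume E' <= volume E)%E].

(* Main.v *)
Require Import Defs.
From HB Require Import structures.
From mathcomp Require Import all_boot all_order all_algebra.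
From mathcomp Require Import perm sesquilinear complex.
From mathcomp Require Import all_classical all_reals all_analysis.
From mathcomp Require Import measurable_realfun.
From mathcomp Require Import ring lra.
Set Implicit Arguments.
Unset Strict Implicit.
Unset Printing Implicit Defensive.
Import Order.TTheory GRing.Theory Num.Theory.
Import numFieldNormedType.Exports.
Local Open Scope classical_set_scope.
Local Open Scope ring_scope.

(** Write an ellipsoid as [T B + c], with [B] the unit ball and [T] invertible.
Two facts about such sets carry the proof.

Volume.  [T B + c] has volume [w * |det T|] over the reals and
[w * |det T|^2] over the complex numbers, where [0 < w < +oo] depends on the
dimension only ([volume_real_ellipsoid], [volume_complex_ellipsoid]).  An
ellipsoid does not determine [T], and by the Cholesky decomposition
([cholesky]) [T] can be taken lower triangular with positive diagonal.  For such
a [T] the change of variables is an iteration of one-dimensional ones: in the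
iterated integral that defines the volume, each section of the image is the
image of a section under a smaller triangular map ([lebesgue_tuple_affine]).
A complex ellipsoid is a real one for the matrix [[Re T, - Im T], [Im T, Re T]],
whose determinant is [|det T|^2] ([det_realify]).  Hence an ellipsoid of maximal
volume in a convex set [C] is one with [|det T|] maximal ([det_maximal_in]).

Midpoints.  If [T1 B + c1] and [T2 B + c2] lie in [C], so does
[(T1 + T2)/2 B + (c1 + c2)/2].

Equality of the shapes ([det_maximal_same_form]): let the two ellipsoids be
translates of [{x | x^T Mi conj(x) <= 1}], i = 1, 2.  Given any nonzero vector [w],
choose coordinates in which [w] is the last basis vector, and take [T1], [T2]
lower triangular with positive diagonals [a], [b] in these coordinates.
Maximality bounds [prod (a_i + b_i)/2], the determinant of the midpoint ellipsoid,
by [prod a_i] and by [prod b_i], so that [a = b] by the inequality of arithmetic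
and geometric means.  The last diagonal entry of [Ti] is [(w^T Mi conj(w))^(-1/2)];
hence the two forms agree at [w].  As [w] is arbitrary, the forms are equal, and
the ellipsoids are translates.

Equality of the centers over the reals ([det_maximal_same_center]): were
[c = c2 - c1] nonzero, the convex hull of the two translates would contain the
midpoint ellipsoid stretched in the direction [c], and the stretching has
determinant greater than 1. *)

(** * Affine substitutions on the line *)

(** Both sides are measures in [A] that agree on half-open intervals. *)
Lemma lebesgue_measure_preimage_affine (R : realType) (l d : R) (hl : 0 < l)
    (A : set (measurableTypeR R)) : measurable A ->
  lebesgue_measure [set x : measurableTypeR R | A ((x - d) / l)] =
  (l%:E * lebesgue_measure A)%E.
Proof.
move=> mA.
pose phi (x : measurableTypeR R) : measurableTypeR R := (x - d) / l.
have mphi : measurable_fun setT phi.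
  apply: measurable_funM => //; exact: measurable_funB.
have l0 : 0 <= l^-1 by rewrite invr_ge0 ltW.
have -> : lebesgue_measure A =
    pushforward (mscale (NngNum l0) (@lebesgue_measure R)) phi A.
  apply: lebesgue_measure_unique => // _ [[a b] _ <-].
  rewrite /= /pushforward /mscale /=.
  rewrite (_ : phi @^-1` _ = `]l * a + d, l * b + d]%classic); last first.
    apply/seteqP; split => x /=; rewrite !in_itv/= /phi;
      by rewrite ltr_pdivlMr// ler_pdivrMr// ltrBrDr lerBlDr ![l * _]mulrC.
  rewrite !lebesgue_measure_itv/= !lte_fin ltrD2r ltr_pM2l//.
  case: ifPn => _; last by rewrite mule0.
  by rewrite -EFinM; congr EFin; field; rewrite gt_eqF.
rewrite /pushforward /mscale /= muleA -EFinM divff ?gt_eqF// mul1e.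
by [].
Qed.

Lemma ge0_integral_affine (R : realType) (l d : R) (hl : 0 < l)
    (h : measurableTypeR R -> \bar R) :
  measurable_fun setT h -> (forall x, 0 <= h x)%E ->
  (\int[@lebesgue_measure R]_x h ((x - d) / l)%R =
   l%:E * \int[@lebesgue_measure R]_x h x)%E.
Proof.
move=> mh h0.
pose phi (x : measurableTypeR R) : measurableTypeR R := (x - d) / l.
have mphi : measurable_fun setT phi.
  apply: measurable_funM => //; exact: measurable_funB.
have l0 : 0 <= l by rewrite ltW.
have := @ge0_integral_pushforward _ _ _ _ R phi mphi (@lebesgue_measure R)
  setT h measurableT mh (fun x _ => h0 x).
rewrite preimage_setT => /esym; rewrite /comp /phi => ->.
have -> : l%:E = (NngNum l0)%:num%:E by [].
rewrite -ge0_integral_mscale//.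
apply: eq_measure_integral => // A mA _.
exact: lebesgue_measure_preimage_affine.
Qed.

(** * Lebesgue measure on tuples as a sigma-finite measure *)

Lemma lebesgue_tupleS (R : realType) (m : nat)
    (A : set (m.+1.-tuple (measurableTypeR R))) :
  lebesgue_tuple A = (\int[@lebesgue_measure R]_x
     lebesgue_tuple [set v : m.-tuple (measurableTypeR R) | A [tuple of x :: v]])%E.
Proof.
rewrite /= /pushforward /product_measure1; apply: eq_integral => x _ /=.
by congr lebesgue_tuple; apply/seteqP; split => v; rewrite /xsection/= inE.
Qed.

Lemma measurable_cons_pair (R : realType) (m : nat) :
  measurable_fun setT
    (fun p : measurableTypeR R * m.-tuple (measurableTypeR R) =>
       [tuple of p.1 :: p.2]).
Proof. exact: measurable_cons. Qed.

(** The integrals below need a bundled sigma-finite measure, whereas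
[lebesgue_tuple] is a bare function, and its sigma-finiteness is only available
inside an induction.  A copy that carries the proof as an argument can be given
the structure. *)
Section SigmaFiniteCopy.
Context d (T : measurableType d) (R : realType).
Variables (M : {measure set T -> \bar R}) (sf : sigma_finite setT M).

Definition sigma_finite_copy (_ : sigma_finite setT M) : set T -> \bar R := M.
HB.instance Definition _ := Measure.on (sigma_finite_copy sf).
HB.instance Definition _ :=
  Measure_isSigmaFinite.Build _ _ _ (sigma_finite_copy sf) sf.

End SigmaFiniteCopy.

(** By induction on the dimension: the product of two sigma-finite measures,
transported along the bijection [(x, v) |-> x :: v], is exhausted by the products
of the members of two increasing exhaustions. *)
Lemma lebesgue_tuple_sigma_finite (R : realType) (m : nat) :
  exists mu : {sigma_finite_measure set (m.-tuple (measurableTypeR R)) -> \bar R},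
    @lebesgue_tuple R m = mu.
Proof.
elim: m => [|m [mu Emu]]; first by exists (\d_[tuple]).
pose p := (fun p : measurableTypeR R * m.-tuple (measurableTypeR R) =>
       [tuple of p.1 :: p.2]).
have mp : measurable_fun setT p by exact: measurable_cons_pair.
pose nu : {measure set _ -> \bar R} := (@lebesgue_measure R \x mu)%E.
(* The measure structure of a pushforward depends on the proof [mp]. *)
pose M : {measure set _ -> \bar R} :=
  measure_function_pushforward__canonical__measure_function_Measure nu mp.
have sf : sigma_finite setT M.
  have /sigma_finiteP[F [TF ndF Foo]] := sigma_finiteT (@lebesgue_measure R).
  have /sigma_finiteP[G [TG ndG Goo]] := sigma_finiteT mu.
  exists (fun i => [set t : m.+1.-tuple (measurableTypeR R) |
                      F i (thead t) /\ G i [tuple of behead t]]).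
    apply/seteqP; split => // t _.
    have : setT (thead t) by [].
    have : setT [tuple of behead t] by [].
    rewrite TF TG => -[j _ Gj] [i _ Fi]; exists (maxn i j) => //; split.
      by move: Fi; exact/subsetPset/ndF/leq_maxl.
    by move: Gj; exact/subsetPset/ndG/leq_maxr.
  move=> i; have [mF Fi] := Foo i; have [mG Gi] := Goo i; split.
    apply: measurableI; rewrite -[X in measurable X]setTI.
      exact: (measurable_tnth ord0 measurableT).
    exact: (@measurable_behead _ (measurableTypeR R) m measurableT).
  rewrite /= /pushforward (_ : _ @^-1` _ = F i `*` G i); last first.
    by apply/seteqP; split => -[x t] /=; rewrite theadE;
      rewrite (_ : [tuple of behead [tuple of x :: t]] = t)//; exact: val_inj.
  by rewrite product_measure1E// lte_mul_pinfty// ge0_fin_numE.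
exists (sigma_finite_copy sf); apply/funext => A.
by rewrite /= Emu.
Qed.

(** * Lebesgue measure under triangular affine maps *)

Definition tuple_col (R : realType) (m : nat)
  (t : m.-tuple (measurableTypeR R)) : 'cV[R]_m := \col_i tnth t i.

Definition col_tuple (R : realType) (m : nat) (x : 'cV[R]_m) :
  m.-tuple (measurableTypeR R) := [tuple x i 0 | i < m].

Lemma col_tupleK (R : realType) (m : nat) :
  cancel (@col_tuple R m) (@tuple_col R m).
Proof. by move=> x; apply/colP => i; rewrite mxE tnth_mktuple. Qed.

Lemma lebesgue_tuple_section (R : realType) (m : nat)
    (A : set (m.+1.-tuple (measurableTypeR R))) : measurable A ->
  [/\ forall x,
     measurable [set v : m.-tuple (measurableTypeR R) | A [tuple of x :: v]],
   measurable_fun setT (fun x : measurableTypeR R =>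
     lebesgue_tuple [set v : m.-tuple (measurableTypeR R) | A [tuple of x :: v]]) &
   forall x, (0 <= lebesgue_tuple
     [set v : m.-tuple (measurableTypeR R) | A [tuple of x :: v]])%E].
Proof.
move=> mA; have [mu muE] := lebesgue_tuple_sigma_finite R m.
pose B := [set p : measurableTypeR R * m.-tuple (measurableTypeR R) |
            A [tuple of p.1 :: p.2]].
have mB : measurable B.
  by rewrite -[X in measurable X]setTI; exact: (measurable_cons_pair measurableT).
have BE x : [set v : m.-tuple (measurableTypeR R) | A [tuple of x :: v]] =
  xsection B x by apply/seteqP; split => v; rewrite /xsection/= inE.
rewrite muE; split=> [x||x].
- by rewrite BE; exact: measurable_xsection.
- rewrite (_ : (fun x => _) = mu \o xsection B).
    exact: measurable_fun_xsection.
  by apply/funext => x /=; rewrite BE.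
- exact: measure_ge0.
Qed.

(** Induction on the dimension.  The first coordinate of [L s + c] depends on the
first coordinate of [s] only, so the section of the image at [x] is the image of
the section at [y = (x - c_0) / L_00] under an affine map whose linear part is the
lower right block of [L], whatever [x] is; only its translation part depends on
[y].  The inductive hypothesis takes care of the sections, and the substitution
[y = (x - c_0) / L_00] of the remaining integral. *)
Lemma lebesgue_tuple_affine (R : realType) (m : nat) (L : 'M[R]_m) (c : 'cV[R]_m)
    (A : set (m.-tuple (measurableTypeR R))) :
  is_trig_mx L -> (forall i, 0 < L i i) -> measurable A ->
  lebesgue_tuple
    [set t | exists2 s, A s & t = col_tuple (L *m tuple_col s + c)] =
  ((\prod_i L i i)%:E * lebesgue_tuple A)%E.
Proof.
move: L c A; elim: m => [|m IH] L c A.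
  move=> _ _ _; rewrite big_ord0 mul1e; congr lebesgue_tuple.
  apply/seteqP; split => t.
    by move=> [s As _]; rewrite (tuple0 t) -(tuple0 s).
  by move=> At; exists t; rewrite // (tuple0 (col_tuple _)) -(tuple0 t).
move=> /is_trig_mxP trigL L0 mA.
pose l := L ord0 ord0.
pose L' := \matrix_(i < m, j < m) L (lift ord0 i) (lift ord0 j).
have trigL' : is_trig_mx L'.
  by apply/is_trig_mxP => i j ij; rewrite mxE trigL// /lift/= /bump/= !add1n ltnS.
pose c' y := \col_(i < m) (L (lift ord0 i) ord0 * y + c (lift ord0 i) 0).
have l0 : 0 < l by exact: L0.
rewrite !lebesgue_tupleS.
have [mAx mh h0] := lebesgue_tuple_section mA.
transitivity (\int[@lebesgue_measure R]_x ((\prod_i L' i i)%:E *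
    lebesgue_tuple [set v : m.-tuple (measurableTypeR R) |
      A [tuple of ((x - c ord0 0) / l)%R :: v]]))%E.
  apply: eq_integral => x _ /=; set y := (x - _) / _.
  rewrite -(IH L' (c' y) _ trigL' _ (mAx y)); last by move=> i; rewrite mxE.
  congr lebesgue_tuple; apply/seteqP; split => v /=.
    move=> [s As /(congr1 (@tnth _ _)) E].
    have Es0 : tnth s ord0 = y.
      have := congr1 (fun f => f ord0) E.
      rewrite tnth0 tnth_mktuple mxE mxE big_ord_recl big1 ?addr0; last first.
        by move=> i _; rewrite trigL ?mul0r.
      rewrite mxE /y => ->; rewrite addrK mulrAC divff ?mul1r// gt_eqF//.
    have Es : s = [tuple of y :: [tuple of behead s]].
      by rewrite [LHS]tuple_eta /thead Es0.
    exists [tuple of behead s]; first by rewrite -Es.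
    apply: eq_from_tnth => i.
    have := congr1 (fun f => f (lift ord0 i)) E.
    rewrite tnthS !tnth_mktuple => ->; rewrite !mxE big_ord_recl.
    rewrite [tuple_col _ _ _]mxE Es0 addrAC addrC; congr (_ + _).
    by apply: eq_bigr => j _; rewrite !mxE [in LHS]Es tnthS.
  move=> [s As ->]; exists [tuple of y :: s] => //.
  apply: eq_from_tnth => i; rewrite tnth_mktuple !mxE.
  case: (unliftP ord0 i) => [j ->|->].
    rewrite tnthS tnth_mktuple !mxE big_ord_recl [tuple_col _ _ _]mxE tnth0.
    rewrite [RHS]addrAC [RHS]addrC; congr (_ + _).
      by apply: eq_bigr => k _; rewrite !mxE tnthS.
  rewrite tnth0 big_ord_recl big1 ?addr0; last first.
    by move=> j _; rewrite trigL ?mul0r.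
  by rewrite mxE tnth0 /y mulrC divfK ?gt_eqF// subrK.
pose h (x : measurableTypeR R) : \bar R :=
  lebesgue_tuple [set v : m.-tuple (measurableTypeR R) | A [tuple of x :: v]].
have p0 : 0 <= \prod_i L' i i by apply: prodr_ge0 => i _; rewrite mxE ltW.
rewrite ge0_integralZl//=; last first.
  apply: (measurableT_comp mh).
  by apply: measurable_funM => //; exact: measurable_funB.
rewrite (@ge0_integral_affine R l (c ord0 0) l0 h)// muleA -EFinM.
congr (_%:E * _)%E; rewrite big_ord_recl mulrC; congr (_ * _).
by apply: eq_bigr => i _; rewrite mxE.
Qed.

(** * The unit ball has positive finite measure *)

Definition tuple_box (R : realType) (m : nat) (a : R) :
    set (m.-tuple (measurableTypeR R)) :=
  [set t | forall i, `|tnth t i| <= a].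

Definition tuple_ball (R : realType) (m : nat) :
    set (m.-tuple (measurableTypeR R)) :=
  [set t | \sum_i tnth t i ^+ 2 <= 1].

Lemma measurable_tuple_box (R : realType) (m : nat) (a : R) :
  measurable (@tuple_box R m a).
Proof.
rewrite /tuple_box (_ : mkset _ = \bigcap_(i in [set: 'I_m])
   ((fun t : m.-tuple (measurableTypeR R) => tnth t i) @^-1` `[- a, a])).
  apply: fin_bigcap_measurable => // i _.
  by rewrite -[X in measurable X]setTI; exact: (measurable_tnth i measurableT).
apply/seteqP; split => t /= ta i; first by move=> _; rewrite /= in_itv/= -ler_norml.
by rewrite ler_norml; have := ta i Logic.I; rewrite /= in_itv.
Qed.

Lemma lebesgue_tuple_box (R : realType) (m : nat) (a : R) : 0 <= a ->
  lebesgue_tuple (@tuple_box R m a) = ((a *+ 2) ^+ m)%:E.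
Proof.
move=> a0; elim: m => [|m IH].
  rewrite /= diracE (_ : _ \in _ = true) ?expr0//.
  by apply/mem_set => -[].
rewrite lebesgue_tupleS.
have mI : measurable (`[- a, a]%classic : set (measurableTypeR R)).
  exact: measurable_itv.
rewrite (eq_integral (fun x => ((a *+ 2) ^+ m)%:E *
   (\1_(`[- a, a]%classic : set (measurableTypeR R)) x)%:E)%E); last first.
  move=> x _; rewrite indicE; have [xa|xa] := boolP (x \in _).
    rewrite mule1 -IH; congr lebesgue_tuple; apply/seteqP; split => v /= va i.
      by have := va (lift ord0 i); rewrite tnthS.
    case: (unliftP ord0 i) => [j ->|->]; first by rewrite tnthS.
    by rewrite tnth0 ler_norml; move/set_mem: xa; rewrite /= in_itv.
  rewrite mule0 (_ : mkset _ = set0).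
    by have [mu ->] := lebesgue_tuple_sigma_finite R m; rewrite measure0.
  apply/seteqP; split => // v /= /(_ ord0); rewrite tnth0 ler_norml => xa'.
  by move/negP: xa; apply; apply/mem_set; rewrite /= in_itv.
rewrite ge0_integralZl// ?lee_fin ?exprn_ge0 ?mulrn_wge0//; last first.
  by apply/measurable_EFinP; exact: measurable_indic.
rewrite integral_indic// setIT/=. rewrite lebesgue_measure_itv/= lte_fin.
case: ifPn => [_|]; first by rewrite -EFinD -EFinM opprK -mulr2n exprSr.
rewrite -leNgt => aa; have -> : a = 0 by lra.
by rewrite mule0 mul0rn expr0n.
Qed.

Lemma measurable_tuple_ball (R : realType) (m : nat) :
  measurable (@tuple_ball R m).
Proof.
rewrite /tuple_ball (_ : mkset _ = (fun t : m.-tuple (measurableTypeR R) =>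
  \sum_i tnth t i ^+ 2 : measurableTypeR R) @^-1` `]-oo, 1]%classic); last first.
  by apply/seteqP; split => t; rewrite /= in_itv.
rewrite -[X in measurable X]setTI.
have mf : measurable_fun setT (fun t : m.-tuple (measurableTypeR R) =>
  \sum_i tnth t i ^+ 2 : measurableTypeR R).
  apply: measurable_sum => i.
  by apply: measurable_funX; exact: measurable_tnth.
by apply: mf => //; exact: measurable_itv.
Qed.

(** The ball lies between two boxes of known positive volume: the one of
half-side 1, and the one of half-side [1 / (m + 1)], for which
[m / (m + 1) ^ 2 <= 1]. *)
Lemma lebesgue_tuple_ball (R : realType) (m : nat) :
  exists2 w : R, 0 < w & lebesgue_tuple (@tuple_ball R m) = w%:E.
Proof.
have [mu muE] := lebesgue_tuple_sigma_finite R m.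
have mB := @measurable_tuple_ball R m.
have up : (lebesgue_tuple (@tuple_ball R m) <= ((1 *+ 2) ^+ m)%:E)%E.
  rewrite -lebesgue_tuple_box// muE le_measure ?inE//.
    exact: measurable_tuple_box.
  move=> t tB i.
  have : tnth t i ^+ 2 <= 1.
    apply: le_trans tB; rewrite (bigD1 i)//= lerDl sumr_ge0// => j _.
    exact: sqr_ge0.
  by rewrite -(real_normK (num_real _)) expr_le1.
pose a : R := (m.+1%:R)^-1.
have a0 : 0 < a by rewrite invr_gt0.
have lo : (((a *+ 2) ^+ m)%:E <= lebesgue_tuple (@tuple_ball R m))%E.
  rewrite -lebesgue_tuple_box ?(ltW a0)// muE le_measure ?inE//.
    exact: measurable_tuple_box.
  move=> t ta; rewrite /tuple_ball/=.
  apply: (@le_trans _ _ (\sum_(i < m) a ^+ 2)).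
    apply: ler_sum => i _; rewrite -(real_normK (num_real _)).
    by rewrite ler_sqr ?nnegrE// ltW.
  rewrite sumr_const card_ord -mulr_natr expr2.
  have am : a * m%:R <= 1 by rewrite ler_pdivrMl// mulr1 ler_nat.
  have a1 : a <= 1 by rewrite invf_le1// ler1n.
  rewrite -mulrA -[X in _ <= X]mulr1 ler_pM ?mulr_ge0 ?ler0n ?(ltW a0)//.
have fin : lebesgue_tuple (@tuple_ball R m) \is a fin_num.
  rewrite fin_numE; apply/andP; split; apply/eqP => E.
    by move: lo; rewrite E.
  by move: up; rewrite E.
exists (fine (lebesgue_tuple (@tuple_ball R m))); last by rewrite fineK.
rewrite -lte_fin fineK//; apply: lt_le_trans lo; rewrite lte_fin.
by rewrite exprn_gt0// pmulrn_lgt0.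
Qed.

(** * Hermitian forms over the real or complex scalars *)

Section Scalars.
Variables (R : realType) (K : scalars).
Local Notation F := (scalar_field R K).
Local Notation conj := (@scalar_conj R K).

Lemma scalar_conjK : involutive conj.
Proof. by case: K => x //=; rewrite conjcK. Qed.

Lemma mulr_scalar_conj (x : F) : x * conj x = `|x| ^+ 2.
Proof.
case: K x => x /=; first by rewrite -expr2 real_normK// num_real.
by rewrite sqr_normc.
Qed.

Lemma scalar_sqrt (x : F) : 0 < x -> exists2 y : F, 0 < y & y ^+ 2 = x.
Proof.
case: K x => x x0.
  by exists (Num.sqrt x); rewrite ?sqrtr_gt0// sqr_sqrtr// ltW.
by exists (sqrtC x); rewrite ?sqrtC_gt0// sqrtCK.
Qed.

Lemma scalar_conj_gt0 (x : F) : 0 < x -> conj x = x.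
Proof.
move=> x0; have x_neq0 : x != 0 by rewrite gt_eqF.
by apply: (mulfI x_neq0); rewrite mulr_scalar_conj gtr0_norm.
Qed.

End Scalars.

Section Congruence.
Variables (R : realType) (K : scalars).
Local Notation F := (scalar_field R K).
Local Notation conj := (@scalar_conj R K).
Local Notation conjmx := (map_mx conj).

Lemma conjmxK (m n : nat) (A : 'M[F]_(m, n)) : conjmx (conjmx A) = A.
Proof. by apply/matrixP => i j; rewrite !mxE scalar_conjK. Qed.

(** The matrix of the form of [M] after the change of variables [x = T y]. *)
Definition congruent (n : nat) (M T : 'M[F]_n) : 'M[F]_n := T^T *m M *m conjmx T.

Lemma herm_form_mul (n : nat) (M T : 'M[F]_n) (x : 'cV[F]_n) :
  herm_form M (T *m x) = herm_form (congruent M T) x.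
Proof. by rewrite /herm_form /congruent trmx_mul map_mxM !mulmxA. Qed.

Lemma congruentM (n : nat) (M S T : 'M[F]_n) :
  congruent M (S *m T) = congruent (congruent M S) T.
Proof. by rewrite /congruent trmx_mul map_mxM !mulmxA. Qed.

Lemma herm_form1 (n : nat) (x : 'cV[F]_n) :
  herm_form 1%:M x = \sum_i `|x i 0| ^+ 2.
Proof.
rewrite /herm_form mulmx1 mxE; apply: eq_bigr => i _.
by rewrite !mxE mulr_scalar_conj.
Qed.

Lemma posdef1 (n : nat) : posdef_hermitian (1%:M : 'M[F]_n).
Proof.
split; first by rewrite sesquiE expr0 scale1r trmx1 map_mx1.
move=> x x0; rewrite herm_form1 lt_neqAle sumr_ge0 ?andbT; last first.
  by move=> i _; exact: exprn_ge0.
apply: contra x0; rewrite eq_sym psumr_eq0; last first.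
  by move=> i _; exact: exprn_ge0.
move=> /allP x0; apply/eqP/colP => i; rewrite mxE; apply/eqP.
by have := x0 i (mem_index_enum i); rewrite sqrf_eq0 normr_eq0.
Qed.

Lemma posdef_congruent (n : nat) (M T : 'M[F]_n) :
  T \in unitmx -> posdef_hermitian M -> posdef_hermitian (congruent M T).
Proof.
move=> uT [hM pM]; split.
  move: hM; rewrite !sesquiE !expr0 !scale1r => /eqP hM; apply/eqP.
  rewrite /congruent !trmx_mul !map_mxM [in LHS]hM trmxK !mulmxA map_trmx.
  congr (_ *m _ *m _); apply/matrixP => i j.
  by rewrite !mxE scalar_conjK.
move=> x x0; rewrite -herm_form_mul; apply: pM.
by apply: contra x0 => /eqP Tx; rewrite -[x](mulKmx uT) Tx mulmx0.
Qed.

Lemma congruent1_unit (n : nat) (M T : 'M[F]_n) :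
  congruent M T = 1%:M -> (M \in unitmx) && (T \in unitmx).
Proof.
rewrite /congruent -mulmxA => /mulmx1_unit [].
by rewrite unitmx_mul unitmx_tr => -> /andP[->].
Qed.

(** Completing the square, one variable at a time.  Split [M] in blocks
[[m, r], [s, M']] with [m] of size 1.  The map [P] that sends the first basis vector
to [(1, z)], where [z] is chosen so that [s + M' conj(z) = 0], and fixes the others
makes [M] block diagonal with blocks [q] and [M']; then [q > 0] is rescaled to 1
and the inductive hypothesis treats [M'].  All factors are lower triangular. *)
Lemma cholesky (n : nat) (M : 'M[F]_n) : posdef_hermitian M ->
  exists L : 'M[F]_n,
    [/\ is_trig_mx L, forall i, 0 < L i i & congruent M L = 1%:M].
Proof.
elim: n M => [|n IH] M pM.
  by exists 1%:M; split;
    [rewrite scalar_mx_is_trig|case|rewrite [LHS]flatmx0 [RHS]flatmx0].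
rewrite -[n.+1]/(1 + n)%N in M pM *.
pose m := ulsubmx M; pose r := ursubmx M; pose s := dlsubmx M.
pose M' := drsubmx M.
have ME : M = block_mx m r s M' by rewrite submxK.
have pM' : posdef_hermitian M'.
  have [hM pM0] := pM; split.
    move: hM; rewrite !sesquiE !expr0 !scale1r => /eqP hM; apply/eqP.
    by rewrite /M' [in LHS]hM; apply/matrixP => i j; rewrite !mxE.
  move=> y y0; have := pM0 (col_mx 0 y).
  rewrite /herm_form ME tr_col_mx map_col_mx mul_row_block mul_row_col.
  rewrite trmx0 !mul0mx !add0r map_mx0 mulmx0 add0r; apply.
  apply: contra y0 => /eqP E; apply/eqP/colP => i.
  by have := congr1 (fun v : 'cV_(1 + n) => v (rshift 1 i) 0) E;
    rewrite /= col_mxEd !mxE.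
have [L' [tL' L'0 L'1]] := IH _ pM'.
have /andP[uM' uL'] := congruent1_unit L'1.
pose z := - conjmx (invmx M' *m s).
pose P : 'M[F]_(1 + n) := block_mx 1%:M 0 z 1%:M.
have uP : P \in unitmx by rewrite unitmxE det_lblock !det1 mulr1 unitr1.
pose N := congruent M P.
have pN : posdef_hermitian N by exact: posdef_congruent.
have zs : s + M' *m conjmx z = 0.
  by rewrite /z map_mxN conjmxK mulmxN mulKVmx// subrr.
have NE : exists q : 'M[F]_1, N = block_mx q 0 0 M'.
  have [hN _] := pN.
  have N21 : dlsubmx N = 0.
    rewrite /N /congruent ME /P tr_block_mx map_block_mx !mulmx_block.
    by rewrite block_mxKdl !trmx0 !trmx1 !map_mx1 !mul0mx !mul1mx !mulmx1 !add0r.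
  have N22 : drsubmx N = M'.
    rewrite /N /congruent ME /P tr_block_mx map_block_mx !mulmx_block.
    rewrite block_mxKdr !trmx0 !trmx1 !map_mx1 !map_mx0 !mul0mx !mul1mx.
    by rewrite !mulmx1 !mulmx0 !add0r.
  have N12 : ursubmx N = 0.
    move: hN; rewrite sesquiE expr0 scale1r => /eqP hN.
    apply/matrixP => i j; rewrite [in LHS]hN !mxE.
    by have /matrixP/(_ j i) := N21; rewrite !mxE => ->; rewrite rmorph0.
  by exists (ulsubmx N); rewrite -[LHS]submxK N21 N22 N12.
have [q NEq] := NE.
have q0 : 0 < q 0 0.
  have := pN.2 (delta_mx 0 0).
  have -> : herm_form N (delta_mx 0 0) = q 0 0.
    rewrite /herm_form trmx_delta map_delta_mx -rowE -colE NEq mxE mxE.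
    have -> : 0 = lshift n 0 :> 'I_(1 + n) by exact: val_inj.
    by rewrite block_mxEul.
  apply; apply/eqP => /matrixP /(_ 0 0); rewrite !mxE !eqxx.
  by apply/eqP; rewrite oner_eq0.
have [a a0 aq] : exists2 a : F, 0 < a & a ^+ 2 * q 0 0 = 1.
  have [a a0 aq] := scalar_sqrt q0; exists a^-1; rewrite ?invr_gt0//.
  by rewrite exprVn -aq mulVf// expf_neq0// gt_eqF.
pose Q : 'M[F]_(1 + n) := block_mx a%:M 0 0 L'.
have PQE : P *m Q = block_mx a%:M 0 (a *: z) L'.
  rewrite /P /Q mulmx_block !mul1mx !mul0mx !mulmx0 !addr0 add0r.
  by rewrite mul_mx_scalar.
exists (P *m Q); rewrite PQE; split.
- apply/is_trig_mxP => i j.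
  case: (split_ordP i) => i' ->; case: (split_ordP j) => j' -> /=.
  + by rewrite !ord1.
  + by rewrite block_mxEur mxE.
  + by rewrite [j']ord1.
  + by rewrite block_mxEdr ltn_add2l; exact: is_trig_mxP.
- move=> i; case: (split_ordP i) => i' ->.
  + by rewrite block_mxEul !ord1 mxE eqxx.
  + by rewrite block_mxEdr.
- rewrite -PQE congruentM -/N NEq /congruent /Q.
  rewrite tr_block_mx map_block_mx !mulmx_block.
  rewrite !trmx0 !map_mx0 !mul0mx !mulmx0 !addr0 !add0r.
  rewrite !mul0mx (_ : 1%:M = block_mx 1%:M 0 0 1%:M :> 'M[F]_(1 + n)); last first.
    by rewrite -scalar_mx_block.
  congr block_mx; last by rewrite -L'1.
  apply/matrixP => i j. rewrite !ord1.
  rewrite tr_scalar_mx map_scalar_mx scalar_conj_gt0//.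
  rewrite mul_scalar_mx mul_mx_scalar scalerA.
  by rewrite -expr2 !mxE aq.
Qed.
End Congruence.

(** * Ellipsoids as affine images of the ball, and their volume *)

Section Ellipsoids.
Variables (R : realType) (K : scalars).
Local Notation F := (scalar_field R K).

Definition unit_ball (n : nat) : set 'cV[F]_n :=
  [set y | herm_form 1%:M y <= 1].

Definition ellipsoid (n : nat) (T : 'M[F]_n) (c : 'cV[F]_n) : set 'cV[F]_n :=
  [set T *m y + c | y in @unit_ball n].

(** [congruent M T = 1] says that [y |-> T y] carries the form of the unit ball
to the form of [M]. *)
Lemma ellipsoid_of_form (n : nat) (M T : 'M[F]_n) (c : 'cV[F]_n) :
  congruent M T = 1%:M ->
  [set x + c | x in [set x | herm_form M x <= 1]] = ellipsoid T c.
Proof.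
move=> MT; have /andP[_ uT] := congruent1_unit MT.
apply/seteqP; split => _ [x /= hx <-].
  exists (invmx T *m x); last by rewrite mulKVmx.
  by rewrite /unit_ball /= -MT -herm_form_mul mulKVmx.
by exists (T *m x) => //=; rewrite herm_form_mul MT.
Qed.

Lemma congruent_invmx (n : nat) (T : 'M[F]_n) : T \in unitmx ->
  congruent (congruent 1%:M (invmx T)) T = 1%:M.
Proof.
move=> uT; rewrite -congruentM mulVmx// /congruent.
by rewrite trmx1 map_mx1 !mulmx1.
Qed.

Lemma is_ellipsoid_ellipsoid (n : nat) (T : 'M[F]_n) (c : 'cV[F]_n) :
  T \in unitmx -> is_ellipsoid (ellipsoid T c).
Proof.
move=> uT; exists (congruent 1%:M (invmx T)), c; split.
  by apply: posdef_congruent; [rewrite unitmx_inv|exact: posdef1].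
by rewrite (ellipsoid_of_form _ (congruent_invmx uT)).
Qed.

Lemma det_congruent (n : nat) (M T : 'M[F]_n) :
  \det (congruent M T) = \det M * `|\det T| ^+ 2.
Proof.
rewrite /congruent !det_mulmx det_tr det_map_mx -mulr_scalar_conj.
by rewrite mulrCA mulrA.
Qed.

(** The Cholesky factor [L] of the form [M] of the ellipsoid and [T] itself both
satisfy [|det M| |det _|^2 = 1]. *)
Lemma ellipsoid_cholesky (n : nat) (T : 'M[F]_n) (c : 'cV[F]_n) :
  T \in unitmx -> exists L : 'M[F]_n,
    [/\ is_trig_mx L, forall i, 0 < L i i, `|\det L| = `|\det T|
      & ellipsoid T c = ellipsoid L c].
Proof.
move=> uT; pose M := congruent 1%:M (invmx T).
have MT : congruent M T = 1%:M by exact: congruent_invmx.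
have pM : posdef_hermitian M.
  by apply: posdef_congruent; [rewrite unitmx_inv|exact: posdef1].
have [L [tL L0 ML]] := cholesky pM.
exists L; split => //.
  have : \det M * `|\det L| ^+ 2 = \det M * `|\det T| ^+ 2.
    by rewrite -!det_congruent ML MT.
  have dM : \det M != 0.
    by have /andP[+ _] := congruent1_unit MT; rewrite unitmxE unitfE.
  by move/(mulfI dM)/eqP; rewrite eqrXn2// => /eqP.
by rewrite -(ellipsoid_of_form _ MT) (ellipsoid_of_form _ ML).
Qed.

End Ellipsoids.

Lemma volume_real_ellipsoid (R : realType) (n : nat) :
  exists2 w : R, 0 < w & forall (T : 'M[R]_n) (c : 'cV[R]_n), T \in unitmx ->
    @volume R RealScalars n (@ellipsoid R RealScalars n T c)
      = (w * `|\det T|)%:E.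
Proof.
have [w w0 wE] := lebesgue_tuple_ball R n; exists w => // T c uT.
have [L [tL L0 dL ->]] := @ellipsoid_cholesky R RealScalars n T c uT.
rewrite -dL /volume.
have <- : [set t | exists2 s, @tuple_ball R n s &
     t = col_tuple (L *m tuple_col s + c)] =
   [set real_coords x | x in @ellipsoid R RealScalars n L c].
  apply/seteqP; split => t.
    move=> [s sB ->]; exists (L *m tuple_col s + c) => //.
    exists (tuple_col s) => //; rewrite /unit_ball/= herm_form1.
    apply: le_trans sB; apply: ler_sum => i _.
    by rewrite mxE real_normK// num_real.
  move=> [_ [y yB <-] <-]; exists (col_tuple y); last by rewrite col_tupleK.
  move: yB; rewrite /unit_ball/= herm_form1; apply: le_trans.
  apply: ler_sum => i _; rewrite tnth_mktuple.
  by rewrite real_normK// num_real.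
rewrite lebesgue_tuple_affine// ?wE; last exact: measurable_tuple_ball.
rewrite (det_trig tL) -EFinM mulrC; congr (_ * _)%:E.
by apply/esym/ger0_norm/prodr_ge0 => i _; exact/ltW/L0.
Qed.

Section Realification.
Variable R : realType.
Local Notation Re := (@complex.Re R).
Local Notation Im := (@complex.Im R).

(** Multiplication by [T], in the real coordinates that list real parts first. *)
Definition realify (n : nat) (T : 'M[R[i]]_n) : 'M[R]_(n + n) :=
  block_mx (map_mx Re T) (- map_mx Im T) (map_mx Im T) (map_mx Re T).

Definition real_vec (n : nat) (x : 'cV[R[i]]_n) : 'cV[R]_(n + n) :=
  col_mx (map_mx Re x) (map_mx Im x).

Lemma ReM (x y : R[i]) : Re (x * y) = Re x * Re y - Im x * Im y.
Proof. by case: x y => [a b] [c d]. Qed.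

Lemma ImM (x y : R[i]) : Im (x * y) = Im x * Re y + Re x * Im y.
Proof. by case: x y => [a b] [c d] /=; rewrite addrC. Qed.

Lemma ReD (x y : R[i]) : Re (x + y) = Re x + Re y.
Proof. by case: x y => [a b] [c d]. Qed.

Lemma ImD (x y : R[i]) : Im (x + y) = Im x + Im y.
Proof. by case: x y => [a b] [c d]. Qed.

Lemma map_Re_mul (m n p : nat) (A : 'M[R[i]]_(m, n)) (B : 'M[R[i]]_(n, p)) :
  map_mx Re (A *m B) = map_mx Re A *m map_mx Re B - map_mx Im A *m map_mx Im B.
Proof.
apply/matrixP => i j; rewrite !mxE (big_morph Re ReD (erefl _)) -sumrB.
by apply: eq_bigr => k _; rewrite !mxE ReM.
Qed.

Lemma map_Im_mul (m n p : nat) (A : 'M[R[i]]_(m, n)) (B : 'M[R[i]]_(n, p)) :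
  map_mx Im (A *m B) = map_mx Im A *m map_mx Re B + map_mx Re A *m map_mx Im B.
Proof.
apply/matrixP => i j; rewrite !mxE (big_morph Im ImD (erefl _)) -big_split.
by apply: eq_bigr => k _; rewrite !mxE ImM.
Qed.

Lemma real_vec_affine (n : nat) (T : 'M[R[i]]_n) (y c : 'cV[R[i]]_n) :
  real_vec (T *m y + c) = realify T *m real_vec y + real_vec c.
Proof.
rewrite /real_vec /realify mul_block_col add_col_mx.
rewrite mulNmx -map_Re_mul -map_Im_mul.
by congr col_mx; apply/colP => i; rewrite ![in LHS]mxE [RHS]mxE ?ReD ?ImD !mxE.
Qed.

Lemma real_vec_surj (n : nat) (v : 'cV[R]_(n + n)) : exists x, real_vec x = v.
Proof.
exists (\col_i Complex (usubmx v i 0) (dsubmx v i 0)).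
rewrite -[RHS]vsubmxK; congr col_mx; apply/colP => i; by rewrite !mxE.
Qed.

(** Over the complex numbers, conjugating by the block unipotent matrix with
upper right block ['i] makes the realification block triangular, with [T] and
its conjugate on the diagonal. *)
Lemma det_realify (n : nat) (T : 'M[R[i]]_n) :
  \det (realify T) = Re (`|\det T| ^+ 2).
Proof.
pose A := map_mx (real_complex R) (map_mx Re T).
pose B := map_mx (real_complex R) (map_mx Im T).
have TE : A + 'i%C *: B = T.
  by apply/matrixP => i j; rewrite !mxE [RHS]complexE.
have TcE : A - 'i%C *: B = map_mx (@conjc R) T.
  apply/matrixP => i j; rewrite !mxE; case: (T i j) => a b /=.
  by simpc.
have i2 : 'i%C * 'i%C = -1 :> R[i] by rewrite -expr2 sqr_i.
have detE : \det (map_mx (real_complex R) (realify T)) = `|\det T| ^+ 2.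
  pose U : 'M[R[i]]_(n + n) := block_mx 1%:M 'i%C%:M 0 1%:M.
  pose V : 'M[R[i]]_(n + n) := block_mx 1%:M (- 'i%C)%:M 0 1%:M.
  have E : U *m map_mx (real_complex R) (realify T) *m V =
     block_mx T 0 B (map_mx (@conjc R) T).
    rewrite /U /V /realify map_block_mx map_mxN -/A -/B !mulmx_block.
    rewrite !mul1mx !mul0mx !mulmx1 !mulmx0 !addr0 !add0r.
    rewrite !mul_scalar_mx !mul_mx_scalar TE -TcE -[in X in block_mx _ X _ _]TE.
    congr block_mx; last by rewrite scaleNr addrC.
    rewrite scaleNr scalerDr scalerA i2 scaleN1r opprD opprK.
    by rewrite [- B + _]addrC addrACA addNr subrr addr0.
  have := congr1 (fun X => \det X) E.
  rewrite !det_mulmx !det_ublock det_lblock !det1 !mul1r !mulr1 => ->.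
  rewrite det_map_mx sqr_normc//.
by rewrite -detE det_map_mx.
Qed.

End Realification.

Lemma volume_complex_ellipsoid (R : realType) (n : nat) :
  exists2 w : R, 0 < w & forall (T : 'M[R[i]]_n) (c : 'cV[R[i]]_n), T \in unitmx ->
    @volume R ComplexScalars n (@ellipsoid R ComplexScalars n T c)
      = (w * complex.Re (`|\det T| ^+ 2))%:E.
Proof.
have [w w0 wE] := volume_real_ellipsoid R (n + n); exists w => // T c uT.
have d0 : 0 < complex.Re (`|\det T| ^+ 2).
  have : 0 < `|\det T| ^+ 2.
    by rewrite exprn_gt0// normr_gt0 -unitfE -unitmxE.
  by rewrite ltcE => /andP[].
have uT' : realify T \in unitmx.
  by rewrite unitmxE unitfE det_realify gt_eqF.
rewrite -[X in w * X](gtr0_norm d0) -det_realify.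
rewrite -(wE _ (real_vec c) uT') /volume; congr lebesgue_tuple.
have coordsE (x : 'cV[R[i]]_n) : @real_coords R ComplexScalars n x =
    @real_coords R RealScalars (n + n) (real_vec x).
  apply: eq_from_tnth => i; rewrite tnth_mktuple.
  case: (split_ordP i) => j ->.
    by rewrite tnth_lshift tnth_mktuple col_mxEu mxE.
  by rewrite tnth_rshift tnth_mktuple col_mxEd mxE.
have ballE (y : 'cV[R[i]]_n) : @unit_ball R ComplexScalars n y <->
    @unit_ball R RealScalars (n + n) (real_vec y).
  rewrite /unit_ball /= !herm_form1 big_split_ord/=.
  have -> : \sum_i `|y i 0| ^+ 2 = (\sum_(i < n) `|real_vec y (lshift n i) 0| ^+ 2 +
    \sum_(i < n) `|real_vec y (rshift n i) 0| ^+ 2)%:C%C.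
    rewrite -big_split/= rmorph_sum; apply: eq_bigr => i _.
    rewrite col_mxEu col_mxEd !mxE -add_Re2_Im2.
    by rewrite !real_normK ?num_real.
  by rewrite (lecR _ 1).
apply/seteqP; split => _ [_ [y yB <-] <-].
  exists (real_vec (T *m y + c)); last by rewrite coordsE.
  exists (real_vec y); first exact/ballE.
  by rewrite real_vec_affine.
have [x xE] := real_vec_surj y.
exists (T *m x + c); last by rewrite coordsE real_vec_affine xE.
by exists x => //; apply/ballE; rewrite xE.
Qed.

(** * Uniqueness of maximal ellipsoids *)

Section MaximalEllipsoids.
Variables (R : realType) (K : scalars).
Local Notation F := (scalar_field R K).

Lemma volume_le_det (n : nat) (T T' : 'M[F]_n) (c c' : 'cV[F]_n) :
  T \in unitmx -> T' \in unitmx ->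
  (volume (ellipsoid T' c') <= volume (ellipsoid T c))%E ->
  `|\det T'| <= `|\det T|.
Proof.
move: T T' c c'; case: K => T T' c c' uT uT'.
  have [w w0 wE] := volume_real_ellipsoid R n.
  by rewrite !wE// lee_fin ler_pM2l.
have [w w0 wE] := volume_complex_ellipsoid R n.
rewrite !wE// lee_fin ler_pM2l// => le.
have : `|\det T'| ^+ 2 <= `|\det T| ^+ 2 :> R[i].
  by rewrite -!add_Re2_Im2 lecR; move: le; rewrite -!add_Re2_Im2.
by rewrite ler_sqr// ?nnegrE.
Qed.

(** Maximality of the volume among the ellipsoids in [C], expressed through
determinants so that the real and the complex case can be treated alike. *)
Definition det_maximal_in (n : nat) (C : set 'cV[F]_n) (T : 'M[F]_n)
    (c : 'cV[F]_n) :=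
  ellipsoid T c `<=` C /\
  forall T' c', T' \in unitmx -> ellipsoid T' c' `<=` C ->
    `|\det T'| <= `|\det T|.

Lemma MaIE_det_maximal (n : nat) (A : set 'cV[F]_n) (T : 'M[F]_n) (c : 'cV[F]_n) :
  T \in unitmx -> is_MaIE A (ellipsoid T c) -> det_maximal_in (convex_hull A) T c.
Proof.
move=> uT [_ sub max]; split=> // T' c' uT' sub'.
apply: (volume_le_det uT uT' (max _ _ sub')).
exact: is_ellipsoid_ellipsoid.
Qed.

Lemma convex_set_comb (n : nat) (C : set 'cV[F]_n) (t : F) (x y : 'cV[F]_n) :
  convex_set C -> 0 <= t <= 1 -> C x -> C y -> C (t *: x + (1 - t) *: y).
Proof.
move=> cC /andP[t0 t1] Cx Cy.
have := cC x y (Itv01 t0 t1); by rewrite !inE; apply.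
Qed.

Lemma convex_hull_convex (n : nat) (A : set 'cV[F]_n) : convex_set (convex_hull A).
Proof.
move=> x y l; rewrite !inE => hx hy B [cB AB].
by have := cB x y l; rewrite !inE; apply; [exact: hx|exact: hy].
Qed.

Lemma ellipsoid_midpoint (n : nat) (C : set 'cV[F]_n) (T1 T2 : 'M[F]_n)
    (c1 c2 : 'cV[F]_n) : convex_set C ->
  ellipsoid T1 c1 `<=` C -> ellipsoid T2 c2 `<=` C ->
  ellipsoid (2^-1 *: (T1 + T2)) (2^-1 *: (c1 + c2)) `<=` C.
Proof.
move=> cC s1 s2 _ [y yB <-].
have -> : (2^-1 *: (T1 + T2)) *m y + 2^-1 *: (c1 + c2) =
    2^-1 *: (T1 *m y + c1) + (1 - 2^-1) *: (T2 *m y + c2).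
  rewrite -scalemxAl -scalerDr mulmxDl addrACA scalerDr; congr (_ + _ *: _).
  by field.
apply: convex_set_comb => //.
- by rewrite invr_ge0 ler0n invf_le1 ?ltr0n// ler1n.
- by apply: s1; exists y.
- by apply: s2; exists y.
Qed.

(** The equality case of the inequality of arithmetic and geometric means, in each
factor: [((a + b) / 2) ^ 2 - a b = ((a - b) / 2) ^ 2]. *)
Lemma prod_mean_eq (I : finType) (a b : I -> F) :
  (forall i, 0 < a i) -> (forall i, 0 < b i) ->
  \prod_i ((a i + b i) / 2) <= \prod_i a i ->
  \prod_i ((a i + b i) / 2) <= \prod_i b i ->
  forall i, a i = b i.
Proof.
move=> a0 b0; set p := \prod_i _ => pa pb i.
have m0 j : 0 < (a j + b j) / 2 by rewrite divr_gt0// addr_gt0.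
have rab j : a j - b j \is Num.real by rewrite rpredB// gtr0_real.
have sq j : ((a j + b j) / 2) ^+ 2 - a j * b j = ((a j - b j) / 2) ^+ 2 by field.
have ab_le j : a j * b j <= ((a j + b j) / 2) ^+ 2.
  rewrite -subr_ge0 sq real_exprn_even_ge0// rpredM// rpredV.
  exact: realn.
apply/eqP/negPn/negP => aib.
have ab_lt : a i * b i < ((a i + b i) / 2) ^+ 2.
  rewrite -subr_gt0 sq real_exprn_even_gt0//=.
    by rewrite mulf_neq0 ?subr_eq0// invr_eq0 pnatr_eq0.
  by rewrite rpredM// rpredV realn.
(* A single pair of distinct factors would make [p ^ 2], the product of the squared
   means, exceed the product of the [a j * b j]. *)
have p0 : 0 < p by apply: prodr_gt0.
have : p ^+ 2 <= \prod_j (a j * b j).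
  by rewrite big_split/= expr2 ler_pM// ltW.
have plt : \prod_j (a j * b j) < p ^+ 2.
  rewrite /p -prodrXl (bigD1 i)//= [ltRHS](bigD1 i)//=.
  apply: (@lt_le_trans _ _
    (((a i + b i) / 2) ^+ 2 * \prod_(j | j != i) (a j * b j))).
    by rewrite ltr_pM2r// prodr_gt0// => j _; rewrite mulr_gt0.
  rewrite ler_pM2l ?exprn_gt0// ler_prod// => j _.
  by rewrite ab_le mulr_ge0// ltW.
by move=> /(lt_le_trans plt); rewrite ltxx.
Qed.

Lemma trig_mx_eq0 (n : nat) (L : 'M[F]_n) (i j : 'I_n) :
  is_trig_mx L -> (i < j)%N -> L i j = 0.
Proof. by move=> /is_trig_mxP; apply. Qed.

Lemma trig_mx_last (n : nat) (L : 'M[F]_n.+1) : is_trig_mx L ->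
  L *m delta_mx ord_max 0 = L ord_max ord_max *: delta_mx ord_max 0 :> 'cV_n.+1.
Proof.
move=> tL; rewrite -colE; apply/colP => i; rewrite !mxE eqxx andbT.
have [->|ne] := eqVneq i ord_max; first by rewrite mulr1.
rewrite mulr0 (trig_mx_eq0 tL)// ltn_neqAle -ltnS ltn_ord andbT.
by move: ne; rewrite -val_eqE.
Qed.

(** The rank decomposition of the one-column matrix [w] expresses [w] as an
invertible matrix applied to the first basis vector, up to a scalar; a
transposition turns the first basis vector into the last. *)
Lemma exists_frame (n : nat) (w : 'cV[F]_n.+1) : w != 0 ->
  exists2 W : 'M[F]_n.+1, W \in unitmx & W *m delta_mx ord_max 0 = w.
Proof.
move=> w0.
pose a := row_ebase w 0 0.
have rE : row_ebase w = a%:M by rewrite [LHS]mx11_scalar.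
have a0 : a != 0.
  by have := row_ebase_unit w; rewrite rE unitmxE det_scalar1 unitfE.
have rk : \rank w = 1%N.
  apply/eqP; rewrite eqn_leq rank_leq_col lt0n mxrank_eq0//.
exists (a *: col_ebase w *m tperm_mx 0 ord_max).
  rewrite unitmx_mul unitmx_perm andbT unitmxZ ?col_ebase_unit// unitfE//.
rewrite -[RHS]mulmx_ebase rk rE mul_mx_scalar -scalemxAl -!scalemxAl; congr (_ *: _).
rewrite -mulmxA; congr (_ *m _); apply/colP => i.
rewrite -row_permE !mxE !eqxx andbT ltnS leqn0 andbb.
rewrite -[nat_of_ord i == 0%N]/(i == 0).
rewrite (can2_eq (tpermK 0 ord_max) (tpermK 0 ord_max)).
by rewrite tpermR.
Qed.

(** The last column of a lower triangular matrix is a multiple of the last basis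
vector; this is why the last diagonal entry of [L] measures the form [M] in the
direction of the last column of [W]. *)
Lemma exists_adapted_cholesky (n : nat) (M W : 'M[F]_n.+1) :
  posdef_hermitian M -> W \in unitmx -> exists L : 'M[F]_n.+1,
  [/\ is_trig_mx L, forall i, 0 < L i i, congruent M (W *m L) = 1%:M &
      L ord_max ord_max ^+ 2 * herm_form M (W *m delta_mx ord_max 0) = 1].
Proof.
move=> pM uW; have [L [tL L0 LE]] := cholesky (posdef_congruent uW pM).
exists L; split=> //; first by rewrite congruentM.
set e := delta_mx _ _; pose a := L ord_max ord_max.
have Le : L *m e = a *: e by exact: trig_mx_last.
have : herm_form 1%:M e = 1.
  rewrite herm_form1 (bigD1 ord_max)//= big1 => [|i ne].
    by rewrite mxE !eqxx normr1 expr1n addr0.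
  by rewrite mxE (negbTE ne) normr0 expr0n.
rewrite herm_form_mul -LE -herm_form_mul Le => <-.
rewrite /herm_form linearZ/= map_mxZ (scalar_conj_gt0 (L0 _)).
by rewrite -!scalemxAl -scalemxAr scalerA [RHS]mxE.
Qed.

(** The two triangular matrices are taken in coordinates adapted to the vector
[w]: equality in the determinant inequality for the midpoint ellipsoid only
identifies diagonal entries, and varying [w] turns this into equality of forms. *)
Lemma det_maximal_same_form (n : nat) (C : set 'cV[F]_n) (M1 M2 : 'M[F]_n)
    (c1 c2 : 'cV[F]_n) :
  convex_set C -> posdef_hermitian M1 -> posdef_hermitian M2 ->
  (forall T, congruent M1 T = 1%:M -> det_maximal_in C T c1) ->
  (forall T, congruent M2 T = 1%:M -> det_maximal_in C T c2) ->
  forall w, herm_form M1 w = herm_form M2 w.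
Proof.
move=> cC pM1 pM2 max1 max2 w.
case: n => [|n] in C M1 M2 c1 c2 cC pM1 pM2 max1 max2 w *.
  by rewrite /herm_form [M1]flatmx0 [M2]flatmx0.
have [->|w0] := eqVneq w 0.
  by rewrite /herm_form trmx0 !mul0mx.
have [W uW <-] := exists_frame w0.
have [L1 [tL1 L10 L1E w1]] := exists_adapted_cholesky pM1 uW.
have [L2 [tL2 L20 L2E w2]] := exists_adapted_cholesky pM2 uW.
have [sub1 m1] := max1 _ L1E.
have [sub2 m2] := max2 _ L2E.
have sub := ellipsoid_midpoint cC sub1 sub2.
pose L := 2^-1 *: (L1 + L2).
have TE : 2^-1 *: (W *m L1 + W *m L2) = W *m L by rewrite -mulmxDr scalemxAr.
have LE i : L i i = (L1 i i + L2 i i) / 2 by rewrite !mxE mulrC.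
have L0 i : 0 < L i i by rewrite LE divr_gt0// addr_gt0.
have tL : is_trig_mx L.
  apply/is_trig_mxP => i j ij.
  by rewrite !mxE (trig_mx_eq0 tL1)// (trig_mx_eq0 tL2)// addr0 mulr0.
have uL : L \in unitmx.
  by rewrite unitmxE unitfE det_trig// gt_eqF// prodr_gt0.
have uWL : W *m L \in unitmx by rewrite unitmx_mul uW.
rewrite TE in sub.
have dW : 0 < `|\det W| by rewrite normr_gt0 -unitfE -unitmxE.
have norm_det (X : 'M[F]_n.+1) : is_trig_mx X -> (forall i, 0 < X i i) ->
    `|\det (W *m X)| = `|\det W| * \prod_i X i i.
  by move=> tX X0;
    rewrite det_mulmx normrM (det_trig tX) [X in _ * X]gtr0_norm// prodr_gt0.
have := m1 _ _ uWL sub; have := m2 _ _ uWL sub.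
rewrite !norm_det// !ler_pM2l// (eq_bigr _ (fun i _ => LE i)) => le2 le1.
have E := prod_mean_eq L10 L20 le1 le2 ord_max.
have a0 : L1 ord_max ord_max ^+ 2 != 0 by rewrite expf_neq0// gt_eqF.
by apply: (mulfI a0); rewrite w1 E w2.
Qed.

End MaximalEllipsoids.

(** In coordinates where the last basis vector is [c = c2 - c1], multiply the last
coordinate of the ball by [1 + d] before applying [L].  This moves the image of
[y] by [d * y_last * L_last,last * c].  With [d = 1 / (2 * L_last,last)] the
displacement is [(y_last / 2) c], and as [|y_last| <= 1] the moved point lies on
the segment between the corresponding points of the two ellipsoids. *)
Lemma det_maximal_same_center (R : realType) (n : nat)
    (C : set 'cV[scalar_field R RealScalars]_n)
    (M : 'M[scalar_field R RealScalars]_n)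
    (c1 c2 : 'cV[scalar_field R RealScalars]_n) :
  convex_set C -> posdef_hermitian M ->
  (forall T, congruent M T = 1%:M -> det_maximal_in C T c1) ->
  (forall T, congruent M T = 1%:M -> det_maximal_in C T c2) ->
  c1 = c2.
Proof.
move=> cC pM max1 max2; apply/eqP; rewrite eq_sym -subr_eq0; apply/negPn/negP.
case: n => [|n] in C M c1 c2 cC pM max1 max2 *.
  by rewrite [_ - _]flatmx0 eqxx.
set c := c2 - c1 => c0.
have [W uW We] := exists_frame c0.
have [L [tL L0 LE _]] := exists_adapted_cholesky pM uW.
have [sub1 m1] := max1 _ LE; have [sub2 _] := max2 _ LE.
set e := delta_mx _ _ in We; set l := L ord_max ord_max.
have l0 : 0 < l by exact: L0.
pose d := (2 * l)^-1.
have d0 : 0 < d by rewrite invr_gt0 mulr_gt0.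
pose Q : 'M[scalar_field R RealScalars]_n.+1 :=
  1%:M + d *: delta_mx ord_max ord_max.
have detQ : \det Q = 1 + d.
  rewrite det_trig; last first.
    apply/is_trig_mxP => i j ij; have ne : i != j by rewrite -val_eqE ltn_eqF.
    rewrite !mxE (negbTE ne) add0r; case: eqP => [ie|]; last by rewrite mulr0.
    by rewrite -ie eq_sym (negbTE ne) mulr0.
  rewrite (bigD1 ord_max)//= big1 => [|i ne].
    by rewrite !mxE !eqxx !mulr1.
  by rewrite !mxE eqxx (negbTE ne) mulr0 addr0.
have Qy (y : 'cV_n.+1) : Q *m y = y + (d * y ord_max 0) *: e.
  rewrite mulmxDl mul1mx -scalemxAl -scalerA; congr (_ + _ *: _).
  rewrite -(mul_delta_mx (0 : 'I_1)) -mulmxA -rowE.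
  by rewrite [row _ _]mx11_scalar mul_mx_scalar mxE.
have uWL : W *m L \in unitmx by have /andP[] := congruent1_unit LE.
have uT : W *m L *m Q \in unitmx.
  by rewrite unitmx_mul uWL unitmxE detQ unitfE gt_eqF// addr_gt0.
have sub : ellipsoid (W *m L *m Q) (2^-1 *: (c1 + c2)) `<=` C.
  move=> _ [y yB <-].
  have y1 : `|y ord_max 0| <= 1.
    move: yB; rewrite /unit_ball/= herm_form1 (bigD1 ord_max)//= => yB.
    rewrite -(@expr_le1 _ 2)//; apply: le_trans yB.
    by rewrite lerDl sumr_ge0// => i _; exact: exprn_ge0.
  (* The weight that displaces the point of the first ellipsoid by
     [(1 + y_last) / 2] times [c]. *)
  pose t := (1 + y ord_max 0) / 2.
  have -> : W *m L *m Q *m y + 2^-1 *: (c1 + c2) =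
      t *: (W *m L *m y + c2) + (1 - t) *: (W *m L *m y + c1).
    rewrite -mulmxA Qy mulmxDr -scalemxAr -[W *m L *m e]mulmxA trig_mx_last//.
    rewrite -scalemxAr We -/l scalerA.
    move: (W *m L *m y) => v; apply/colP => i; rewrite !mxE /d /t.
    by field; rewrite gt_eqF.
  apply: convex_set_comb => //.
  - by move: y1; rewrite /t ler_norml => /andP[? ?]; apply/andP; split; lra.
  - by apply: sub2; exists y.
  - by apply: sub1; exists y.
have := m1 _ _ uT sub.
have dWL : 0 < `|\det (W *m L)| by rewrite normr_gt0 -unitfE -unitmxE.
rewrite det_mulmx normrM detQ ger_pMr// gtr0_norm ?addr_gt0// gerDl.
by rewrite leNgt d0.
Qed.

Theorem theorem1 (R : realType) (K : scalars) (n : nat)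
    (A E1 E2 : set 'cV[scalar_field R K]_n) :
  (0 < n)%N -> compact A -> non_flat A ->
  is_MaIE A E1 -> is_MaIE A E2 ->
  (exists c : 'cV[scalar_field R K]_n, E2 = [set x + c | x in E1]) /\
  (K = RealScalars -> E1 = E2).
Proof.
move=> _ _ _ max1 max2.
have [[M1 [c1 [pM1 E1E]]] _ _] := max1.
have [[M2 [c2 [pM2 E2E]]] _ _] := max2.
have cC := @convex_hull_convex R K n A.
have maxM (M : 'M[scalar_field R K]_n) c (E : set 'cV[scalar_field R K]_n) :
    is_MaIE A E -> E = [set x + c | x in [set x | herm_form M x <= 1]] ->
    forall T, congruent M T = 1%:M -> det_maximal_in (convex_hull A) T c.
  move=> maxE EE T MT; have /andP[_ uT] := congruent1_unit MT.
  by apply: MaIE_det_maximal => //; rewrite -(ellipsoid_of_form _ MT) -EE.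
have m1 := maxM _ _ _ max1 E1E; have m2 := maxM _ _ _ max2 E2E.
have M12 := det_maximal_same_form cC pM1 pM2 m1 m2.
have E2E1 : E2 = [set x + c2 | x in [set x | herm_form M1 x <= 1]].
  by rewrite E2E; congr image; apply/funext => x /=; rewrite M12.
split.
  exists (c2 - c1); rewrite E2E1 E1E image_comp; congr image.
  by apply/funext => x /=; rewrite -addrA subrKC.
move: A E1 E2 max1 max2 M1 c1 pM1 E1E M2 c2 pM2 E2E cC maxM m1 m2 M12 E2E1.
case: K => //= A E1 E2 max1 max2 M1 c1 pM1 E1E
  M2 c2 pM2 E2E cC maxM m1 m2 M12 E2E1 _.
rewrite E2E1 E1E (det_maximal_same_center cC pM1 m1 (maxM _ _ _ max2 E2E1))//.
Qed.
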